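(* Let $(\mathfrak h,(H_i,L_i)_{i\in I})$ be a linear Coxeter system with linear Coxeter group $\mathcal W$, closed fundamental chamber $\overline C$ and Tits cone $X$. Let $Y\subseteq X$ be a $\mathcal W$-invariant convex subcone containing $0$. Let $R_1,R_2\in\Upsilon$ and $\sigma_1,\sigma_2\in\mathcal W$. The following are equivalent: (i) $\sigma_1R_1\subseteq\sigma_2R_2$. (ii) $R_1\subseteq R_2$ and $\sigma_1N_{\mathcal W}(R_1)\cap\sigma_2N_{\mathcal W}(R_2)\neq\emptyset$. (iii) $R_1\subseteq R_2$ and $\sigma_1^{-1}\sigma_2\in N_{\mathcal W}(R_1)N_{\mathcal W}(R_2)=\mathcal W_{\upsilon_*(R_1)}\mathcal W_{\upsilon^*(R_2)}$.
   Context: $\mathbb R^+=(0,\infty)$. A convex cone is a subset of a real vector space closed under addition and under multiplication by elements of $\mathbb R^+$. $\mathrm{ri}$ denotes the relative interior of a finite-dimensional convex set. For a convex cone $K$ containing $0$, a face of $K$ is a convex cone $F\subseteq K$ with $(K\setminus F)+K\subseteq K\setminus F$; $\mathrm{Fa}(K)$ is the set of nonempty faces, ordered by inclusion. Linear Coxeter systems. Let $\mathfrak h$ be a finite-dimensional real vector space, $n\ge1$, $I=\{1,\dots,n\}$. For a zero-based closed ray $H\subseteq\mathfrak h$ put $H^{\ge0}=\{\lambda\in\mathfrak h^*\mid\lambda(h)\ge0\ \forall h\in H\}$, $H^{>0}=\{\lambda\mid\lambda(h)>0\ \forall h\in H\setminus\{0\}\}$, $H^{=0}=\{\lambda\mid\lambda(h)=0\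 \forall h\in H\}$. A linear Coxeter system $(\mathfrak h,(H_i,L_i)_{i\in I})$ consists of zero-based closed rays $H_i\subseteq\mathfrak h$, $L_i\subseteq\mathfrak h^*$ with $L_i\setminus\{0\}\subseteq H_i^{>0}$ such that: (1) the closed fundamental chamber $\overline C=\bigcap_{i\in I}H_i^{\ge0}$ spans $\mathfrak h^*$, and $\overline C\cap H_i^{=0}$, $i\in I$, are its pairwise different faces of codimension 1; (2) with $C=\bigcap_{i\in I}H_i^{>0}$ and $\mathcal W$ (the linear Coxeter group) the group generated by the reflections $\sigma_i$ on $\mathfrak h^*$ at the hyperplane $H_i^{=0}$ along the line $L_i\cup(-L_i)$, one has $\sigma C\cap C=\emptyset$ for all $\sigma\in\mathcal W\setminus\{1\}$. $\mathcal W_J$ is the subgroup generated by $\sigma_j$, $j\in J$. The Tits cone is the convex cone $X=\bigcup_{\sigma\in\mathcal W}\sigma\overline C$. $\Upsilon=\{R\in\mathrm{Fa}(Y)\mid\mathrm{ri}(R)\cap\overline C\ne\emptyset\}$. For $R\in\Upsilon$: $\upsilon(R)=\{i\in I\mid\sigma_iR=R\}$, $\upsilon_*(R)=\{i\in I\mid\sigma_i\text{ fixes }R\text{ pointwise}\}$, $\upsilon^*(R)=\upsilon(R)\setminus\upsilon_*(R)$. $N_{\mathcal W}(R)=\{\sigma\in\mathcal W\mid\sigma R=R\}$. *)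

(* Defs.v *)
From HB Require Import structures.
From mathcomp Require Import all_boot all_order all_algebra.
From mathcomp Require Import boolp classical_sets reals topology normedtype.

Set Implicit Arguments.
Unset Strict Implicit.
Unset Printing Implicit Defensive.

Import Order.TTheory GRing.Theory Num.Theory.
Import numFieldNormedType.Exports.
Local Open Scope classical_set_scope.
Local Open Scope ring_scope.

Section ConvexCones.
Context {R : realType} {V : vectType R}.
Implicit Types (A K F : set V) (U : {vspace V}).

(* The empty set is a convex cone. *)
Definition convex_cone K :=
  (forall x y, K x -> K y -> K (x + y)) /\
  (forall (t : R) x, 0 < t -> K x -> K (t *: x)).

Definition face K F :=
  [/\ convex_cone F, F `<=` K
    & forall x y, (K `\` F) x -> K y -> (K `\` F) (x + y)].

Definition Fa K : set (set V) := [set F | face K F /\ F !=set0].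

Definition is_span A U :=
  A `<=` [set` U] /\ forall U', A `<=` [set` U'] -> (U <= U')%VS.

(* A nonempty face of a cone containing 0 contains 0, so its dimension, that of
   its affine hull, is the dimension of its linear span. *)
Definition face_codim1 K F :=
  exists U U', [/\ is_span K U, is_span F U' & \dim U = (\dim U').+1].

(* The topology of the finite-dimensional space V, transported from R^n along
   the coordinates in a basis; it does not depend on the basis. *)
Definition vopen A := open (passmx.vecof (vbasis {:V}) @^-1` A).

Definition affine_set A :=
  forall x y (t : R), A x -> A y -> A (t *: x + (1 - t) *: y).

Definition aff_hull A := smallest affine_set A.

Definition ri A : set V :=
  [set x | A x /\ exists B, [/\ vopen B, B x & B `&` aff_hull A `<=` A]].

Definition closed_ray A :=
  exists2 v : V, v != 0 & A = [set t *: v | t in [set t : R | 0 <= t]].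

End ConvexCones.

Section LinearGroups.
Context {R : realType} {V : vectType R}.
Implicit Types (S A B : set 'End(V)) (s : 'End(V)).

(* On maps with trivial kernel, [(s^-1)%VF] is the inverse of s. *)
Definition is_subgroup S :=
  [/\ forall s, S s -> lker s == 0%VS, S \1%VF,
      forall s t, S s -> S t -> S (s \o t)%VF
    & forall s, S s -> S (s^-1)%VF].

Definition gen_subgroup S := smallest is_subgroup S.

Definition mulset A B := [set (s \o t)%VF | s in A & t in B].

Definition lcoset s A := [set (s \o t)%VF | t in A].

End LinearGroups.

Section LinearCoxeterSystems.
Context {R : realType} {h : vectType R}.
Implicit Types (Hi : set h) (Li : set 'Hom(h, R^o)).

Definition nneg_on Hi : set 'Hom(h, R^o) := [set l | forall x, Hi x -> 0 <= l x].
Definition pos_on Hi : set 'Hom(h, R^o) :=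
  [set l | forall x, Hi x -> x != 0 -> 0 < l x].
Definition zero_on Hi : set 'Hom(h, R^o) := [set l | forall x, Hi x -> l x = 0].

Definition is_reflection Hi Li (s : 'End('Hom(h, R^o))) :=
  (forall l, zero_on Hi l -> s l = l) /\ (forall l, Li l -> s l = - l).

Definition reflection Hi Li : 'End('Hom(h, R^o)) :=
  xget \1%VF [set s | is_reflection Hi Li s].

Lemma reflectionP Hi Li :
  closed_ray Hi -> closed_ray Li -> Li `\ 0 `<=` pos_on Hi ->
  forall s, is_reflection Hi Li s <-> s = reflection Hi Li.
Proof.
move=> [v v0 HE] [a a0 LE] LH.
have Hv : Hi v by rewrite HE; exists 1; rewrite /= ?ler01 ?scale1r.
have La : Li a by rewrite LE; exists 1; rewrite /= ?ler01 ?scale1r.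
have av : 0 < a v by apply: LH => //; split=> //; apply/eqP.
have avN0 : a v != 0 by rewrite gt_eqF.
have refl_uniq s t : is_reflection Hi Li s -> is_reflection Hi Li t -> s = t.
  move=> [s1 s2] [t1 t2]; apply/lfunP => l.
  have z : zero_on Hi (l - (l v / a v : R) *: a).
    move=> x; rewrite HE => -[c _ <-].
    rewrite linearZ /= add_lfunE opp_lfunE scale_lfunE.
    by rewrite /GRing.scale /= divfK // subrr mulr0.
  rewrite -[l](subrK ((l v / a v : R) *: a)).
  rewrite [LHS]linearD [RHS]linearD; congr (_ + _); first by rewrite /= s1 // t1.
  by rewrite [LHS]linearZ [RHS]linearZ /= s2 // t2.
pose f (l : 'Hom(h, R^o)) : 'Hom(h, R^o) := l - (2 * (l v / a v) : R) *: a.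
have f_lin : linear f.
  move=> c l l'; rewrite /f add_lfunE scale_lfunE scalerBr scalerA.
  rewrite addrACA -opprD -scalerDl; congr (_ - _ *: _).
  by rewrite [c * (2 * _)]mulrCA -mulrDr; congr (_ * _); rewrite mulrDl mulrA.
pose fL := GRing.isLinear.Build R _ _ _ f f_lin.
pose fl : {linear 'Hom(h, R^o) -> 'Hom(h, R^o)} := HB.pack f fL.
have f_refl : is_reflection Hi Li (linfun fl).
  split=> l; rewrite lfunE /= /f; first by move=> /(_ v Hv) ->;
    rewrite mul0r mulr0 scale0r subr0.
  rewrite LE => -[c _ <-]; rewrite scale_lfunE /GRing.scale /= mulfK //.
  rewrite -scalerBl -[RHS]scaleNr; congr (_ *: _).
  by rewrite mulr_natl mulr2n opprD addrA subrr sub0r.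
move=> s; split=> [sP|->].
  by apply: refl_uniq => //; apply: (@xgetPex _ _ [set s | is_reflection Hi Li s]);
    exists s.
by apply: (@xgetPex _ _ [set s | is_reflection Hi Li s]); exists (linfun fl).
Qed.

Variables (n : nat) (H : 'I_n -> set h) (L : 'I_n -> set 'Hom(h, R^o)).

Definition sigma i := reflection (H i) (L i).

Definition Cbar := \bigcap_i nneg_on (H i).
Definition C := \bigcap_i pos_on (H i).

Definition parabolic (J : set 'I_n) := gen_subgroup [set sigma j | j in J].
Definition W := parabolic setT.

Record linear_coxeter_system : Prop := {
  lcs_rank : (0 < n)%N;
  lcs_rayH : forall i, closed_ray (H i);
  lcs_rayL : forall i, closed_ray (L i);
  lcs_pos : forall i, L i `\ 0 `<=` pos_on (H i);
  lcs_span : is_span Cbar fullv;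
  lcs_faces : [set F | Fa Cbar F /\ face_codim1 Cbar F] =
              [set Cbar `&` zero_on (H i) | i in setT];
  lcs_faces_inj : injective (fun i => Cbar `&` zero_on (H i));
  lcs_chamber : forall s, W s -> s <> \1%VF -> [set s l | l in C] `&` C = set0
}.

Definition tits_cone := \bigcup_(s in W) [set s l | l in Cbar].

Definition W_invariant (Y : set 'Hom(h, R^o)) :=
  forall s, W s -> [set s l | l in Y] = Y.

Definition Upsilon (Y : set 'Hom(h, R^o)) : set (set 'Hom(h, R^o)) :=
  [set F | Fa Y F /\ ri F `&` Cbar !=set0].

Definition upsilon (F : set 'Hom(h, R^o)) : set 'I_n :=
  [set i | [set sigma i l | l in F] = F].
Definition upsilon_lower (F : set 'Hom(h, R^o)) : set 'I_n :=
  [set i | forall l, F l -> sigma i l = l].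
Definition upsilon_upper F := upsilon F `\` upsilon_lower F.

Definition normW (F : set 'Hom(h, R^o)) :=
  [set s | W s /\ [set s l | l in F] = F].

End LinearCoxeterSystems.

(* Main.v *)
(* A wall of one chamber cannot cut another chamber, since the chamber and its
   reflection would then overlap. This yields the exchange condition, and from
   it, by induction on word length, that the closed chamber is a fundamental
   domain whose point stabilizers are generated by simple reflections.
   Every face R in Upsilon contains a point x of the closed chamber, in its
   relative interior, lying only on those walls that contain R. If s R1 is
   contained in R2 and s x1 is on the negative side of the wall i, then the
   segment from x2 to s x1 meets this wall in the relative interior of R2, so
   sigma_i preserves R2 and s may be replaced by the shorter sigma_i s; if s x1 is
   in the closed chamber, then s fixes R1 pointwise. So s lies in
   W_{upsilon(R2)} W_{upsilon_*(R1)} and R1 is contained in R2. *)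
Require Import Defs.
From HB Require Import structures.
From mathcomp Require Import all_boot all_order all_algebra.
From mathcomp Require Import boolp classical_sets reals topology normedtype.
From mathcomp Require Import lra ring.
Set Implicit Arguments.
Unset Strict Implicit.
Unset Printing Implicit Defensive.

Import Order.TTheory GRing.Theory Num.Theory.
Import numFieldNormedType.Exports.
Local Open Scope classical_set_scope.
Local Open Scope ring_scope.

(** * Convex cones and their faces *)

Section Faces.
Variables (R : realType) (E : vectType R).
Implicit Types (Y F G : set E).

(* The algebraic counterpart of [ri], for which no topology is needed. *)
Definition core F x := F x /\ forall y, F y -> exists2 e, 0 < e & F (x - e *: y).

Lemma cone_add_scale F x y e :
  convex_cone F -> F x -> F y -> 0 <= e -> F (x + e *: y).
Proof.
move=> [FD FZ] Fx Fy; rewrite le_eqVlt => /predU1P[<-|e0].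
  by rewrite scale0r addr0.
by apply: FD => //; apply: FZ.
Qed.

Lemma cone_unscale F e x : convex_cone F -> 0 < e -> F (e *: x) -> F x.
Proof.
move=> [_ FZ] e0 /(FZ e^-1); rewrite invr_gt0 => /(_ e0).
by rewrite scalerA mulVf ?gt_eqF// scale1r.
Qed.

Lemma core_add_scale F x y e :
  convex_cone F -> core F x -> F y -> 0 <= e -> core F (x + e *: y).
Proof.
move=> Fc [Fx xP] Fy e0; split=> [|z /xP[d d0 Fd]]; first exact: cone_add_scale.
by exists d => //; rewrite addrAC; apply: cone_add_scale.
Qed.

Lemma face_cone Y F : face Y F -> convex_cone F. Proof. by case. Qed.
Lemma face_sub Y F : face Y F -> F `<=` Y. Proof. by case. Qed.

Lemma face_summand Y F x y : face Y F -> Y x -> Y y -> F (x + y) -> F x.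
Proof.
by move=> [_ _ H] Yx Yy Fxy; apply: contrapT => nFx; case: (H x y).
Qed.

End Faces.

(** * Reflections, words in them, and the chambers they move *)

Section ReflectionChamber.
Variables (R : realType) (E : vectType R) (n : nat).
Variables (chi : 'I_n -> {scalar E}) (alpha : 'I_n -> E).

(** [alpha i] is the root and [chi i] the coroot of the reflection. Group elements are handled as
    words, not necessarily reduced. *)
Definition refl i x := x - chi i x *: alpha i.
Definition act (t : seq 'I_n) x := foldr refl x t.
Definition chamber x := forall i, 0 < chi i x.
Definition dominant x := forall i, 0 <= chi i x.

Lemma act_linear t a x y : act t (a *: x + y) = a *: act t x + act t y.
Proof.
elim: t => //= i t ->; rewrite /refl linearP scalerBr scalerDl -scalerA.
by rewrite opprD addrACA.
Qed.

Lemma actD t x y : act t (x + y) = act t x + act t y.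
Proof. by rewrite -[x in LHS]scale1r act_linear scale1r. Qed.

Lemma act0 t : act t 0 = 0.
Proof. by apply: (addIr (act t 0)); rewrite -actD !add0r. Qed.

Lemma actZ t a x : act t (a *: x) = a *: act t x.
Proof. by have := act_linear t a x 0; rewrite act0 !addr0. Qed.

Lemma act_cat t u x : act (t ++ u) x = act t (act u x).
Proof. exact: foldr_cat. Qed.

Lemma act_rcons t j x : act (rcons t j) x = act t (refl j x).
Proof. by rewrite -cats1 act_cat. Qed.

Lemma refl_fix i x : chi i x = 0 -> refl i x = x.
Proof. by rewrite /refl => ->; rewrite scale0r subr0. Qed.

Lemma act_fix t x : (forall i, i \in t -> chi i x = 0) -> act t x = x.
Proof.
elim: t => //= i t IH H; rewrite IH ?refl_fix ?H ?mem_head// => k kt.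
by apply: H; rewrite inE kt orbT.
Qed.

(** One step serves all indices: [S] exceeds every ratio [|b i| / |a i|], where division by 0 gives
    0. *)
Lemma exists_small_step (a b : 'I_n -> R) :
  exists2 e, 0 < e & forall i, 0 < a i -> 0 < a i + e * b i.
Proof.
pose S := 1 + \sum_i `|b i| / `|a i|.
have S0 : 0 < S by rewrite ltr_pwDl// sumr_ge0// => i _; rewrite divr_ge0.
exists S^-1 => [|i ai]; first by rewrite invr_gt0.
rewrite -(pmulr_rgt0 _ S0) mulrDr mulrA mulfV ?gt_eqF// mul1r.
have H : `|b i| < S * a i.
  rewrite -ltr_pdivrMr// -[a i in X in X < _]gtr0_norm// /S (bigD1 i)//= addrCA.
  by rewrite ltrDl ltr_pwDl// sumr_ge0// => k _; rewrite divr_ge0.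
by have := ler_norm (- b i); rewrite normrN; lra.
Qed.

Hypothesis chi_alpha : forall i, chi i (alpha i) = 2.
Variable c0 : E.
Hypothesis c0P : chamber c0.
Variable f : 'I_n -> E.
Hypothesis chi_f : forall i, chi i (f i) = 0.
Hypothesis chi_f_gt0 : forall i k, k != i -> 0 < chi k (f i).
(** Dual form of the statement that the dominant points of a wall span its hyperplane. *)
Hypothesis wall_span : forall i (phi : {scalar E}),
  (forall x, dominant x -> chi i x = 0 -> phi x = 0) ->
  forall x, chi i x = 0 -> phi x = 0.
Hypothesis chamber_free : forall t c, chamber c -> chamber (act t c) -> act t =1 id.

Lemma chi_refl i x : chi i (refl i x) = - chi i x.
Proof. by rewrite /refl linearB linearZ /= chi_alpha; lra. Qed.

Lemma reflK i : involutive (refl i).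
Proof.
move=> x; rewrite {1}/refl chi_refl scaleNr opprK /refl.
by rewrite subrK.
Qed.

Lemma act_revK t : cancel (act t) (act (rev t)).
Proof.
by elim: t => //= i t IH x; rewrite rev_cons act_rcons reflK IH.
Qed.

Lemma act_rev_K t : cancel (act (rev t)) (act t).
Proof. by move=> x; rewrite -{1}[t]revK act_revK. Qed.

(** If [act t c] lay on the wall of [i], the conjugate of [refl i] by [t] would fix [c], hence be
    trivial; but [refl i] negates [chi i], which is 2 at [alpha i]. *)
Lemma chi_act_neq0 i t c : chamber c -> chi i (act t c) != 0.
Proof.
move=> cc; apply/eqP => ci0.
have fixed : act (rev t ++ i :: t) c = c.
  by rewrite act_cat /= refl_fix// act_revK.
have := chamber_free (t := rev t ++ i :: t) cc.
rewrite fixed => /(_ cc) /(_ (act (rev t) (alpha i))).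
rewrite act_cat /= act_rev_K => /(can_inj (act_revK (rev t))) e.
by have := chi_refl i (alpha i); rewrite e chi_alpha; lra.
Qed.

(** Were the signs opposite, some combination of [c0] and [x] would be a chamber point that [act t]
    sends onto the wall. *)
Lemma one_side i t x : dominant x -> 0 <= chi i (act t c0) * chi i (act t x).
Proof.
move=> dx; rewrite leNgt; apply/negP => lt0.
have [a [b [a0 b0 ab]]] : exists a b, [/\ 0 < a, 0 <= b &
    a * chi i (act t c0) + b * chi i (act t x) = 0].
  have [cp|cn] := ltP 0 (chi i (act t c0)).
    exists (- chi i (act t x)), (chi i (act t c0)); split; [nra|lra|lra].
  by exists (chi i (act t x)), (- chi i (act t c0)); split; [nra|lra|lra].
have cc : chamber (a *: c0 + b *: x).
  by move=> k; rewrite linearD !linearZ /= ltr_pwDl// ?mulr_gt0// ?mulr_ge0.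
have := chi_act_neq0 i t cc.
by rewrite actD !actZ linearD !linearZ /= ab eqxx.
Qed.

Lemma act_scalar_subproof i t : scalar (fun x => chi i (act t x)).
Proof. by move=> a x y; rewrite act_linear linearP. Qed.

(* If a wall separates two adjacent chambers, it is their common wall; the two
   chambers then both meet every neighbourhood of [act t (f j)] on the same side. *)
Lemma same_wall i j t :
  0 < chi i (act t c0) -> chi i (act t (refl j c0)) < 0 ->
  forall x, refl i (act t x) = act t (refl j x).
Proof.
move=> pos neg.
pose phiL := GRing.isLinear.Build R E R *%R _ (act_scalar_subproof i t).
pose phi : {scalar E} := HB.pack (fun x => chi i (act t x)) phiL.
(* For dominant [x] on the wall of [j], [act t x] lies in the closures of two chambers on opposite
   sides of the wall of [i], hence on that wall. *)
have phi0 x : chi j x = 0 -> chi i (act t x) = 0.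
  apply: (wall_span (i := j) (phi := phi)) => {}x dx xj /=.
  have := one_side i t dx; have := one_side i (rcons t j) dx.
  by rewrite !act_rcons (refl_fix xj) => ? ?; nra.
(* The conjugate of [refl i] by [t]. It fixes the wall of [j] pointwise and moves [c0] across it; it
   will turn out to be [refl j]. *)
pose u := rev t ++ i :: t.
have ufix x : chi j x = 0 -> act u x = x.
  by move=> xj; rewrite /u act_cat /= refl_fix ?phi0// act_revK.
have uneg : chi j (act u c0) < 0.
  have : chi i (act t (act u c0)) < 0.
    by rewrite /u act_cat act_rev_K /= chi_refl oppr_lt0.
  have := phi0 (chi j c0 *: act u c0 - chi j (act u c0) *: c0).
  rewrite -scaleNr actD !actZ !linearD !linearZ /= mulNr mulrC subrr => /(_ erefl).
  have := c0P j => ? ? ?.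
  by rewrite ltNge; apply/negP => ?; nra.
have [e e0 He] := exists_small_step (fun k => chi k (f j))
  (fun k => chi k (refl j (act u c0))).
have fixed : act (j :: u) =1 id.
  apply: (chamber_free (c := f j + e *: c0)) => k; rewrite ?actD ?actZ.
    rewrite linearD linearZ /=; have := c0P k.
    have [->|/chi_f_gt0] := eqVneq k j; first by rewrite chi_f; nra.
    by nra.
  rewrite /= ufix// (refl_fix (chi_f j))// linearD linearZ /=.
  have [->|kj] := eqVneq k j; last by rewrite He// chi_f_gt0.
  by rewrite chi_f add0r chi_refl mulr_gt0// oppr_gt0.
by move=> x; rewrite -[in RHS](fixed x) /= /u act_cat /= reflK act_rev_K.
Qed.

(** Induction on the last letter [j]: if the prefix already puts [c0] on the negative side, the
    shortening takes place inside it; otherwise the last letter crosses the wall of [i], and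
    dropping it amounts to reflecting. *)
Lemma exchange i t : chi i (act t c0) < 0 ->
  exists2 t', (size t' < size t)%N & forall x, act t' x = refl i (act t x).
Proof.
elim/last_ind: t => [|t j IH]; first by move=> /=; have := c0P i; lra.
have [/IH [t' lt_t' t'E] _|] := ltP (chi i (act t c0)) 0.
  exists (rcons t' j) => [|x]; first by rewrite !size_rcons.
  by rewrite !act_rcons t'E.
rewrite le_eqVlt eq_sym (negPf (chi_act_neq0 i t c0P)) /= act_rcons => pos neg.
exists t => [|x]; first by rewrite size_rcons.
by rewrite act_rcons -(same_wall pos neg) reflK.
Qed.

Lemma word_ind (P : seq 'I_n -> Prop) :
  (forall t, (forall u, (size u < size t)%N -> P u) -> P t) -> forall t, P t.
Proof.
move=> H t; elim: (size t).+1 {-2}t (ltnSn (size t)) => // m IH {}t tm.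
by apply: H => u ut; apply: IH; exact: leq_trans ut _.
Qed.

(** If the wall of the first letter [i] separates [c0] from its image, the dominant image of [x]
    lies on this wall and [i] goes into [u]; otherwise [exchange] shortens the word. *)
Lemma fundamental_domain t x : dominant x -> dominant (act t x) ->
  act t x = x /\ exists2 u, (forall i, i \in u -> chi i x = 0) & act u =1 act t.
Proof.
move=> dx; elim/word_ind: t => -[|i t] IH; first by move=> _; split=> //; exists [::].
move=> dtx.
have [neg|pos] := ltP (chi i (act (i :: t) c0)) 0.
  have xi : chi i (act (i :: t) x) = 0.
    by have := one_side i (i :: t) dx; have := dtx i; nra.
  have e : act (i :: t) x = act t x by rewrite -(refl_fix xi) /= reflK.
  have dtx' : dominant (act t x) by rewrite -e.
  have [ex [u uP uE]] := IH t (ltnSn _) dtx'.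
  rewrite e ex in xi.
  split; first by rewrite e.
  exists (i :: u) => [k|y]; last by rewrite /= uE.
  by rewrite inE => /predU1P[->|/uP].
have neg : chi i (act t c0) < 0.
  move: pos; rewrite le_eqVlt eq_sym (negPf (chi_act_neq0 i (i :: t) c0P)) /=.
  by rewrite chi_refl oppr_gt0.
have [t' lt_t' t'E] := exchange neg.
have [||ex [u uP uE]] := IH t'.
- exact: ltn_trans lt_t' (ltnSn _).
- by rewrite t'E.
by rewrite /= -t'E; split=> //; exists u => // y; rewrite uE t'E.
Qed.

Lemma dominantPn x : dominant x \/ exists i, chi i x < 0.
Proof.
have [/forallP dx|/forallPn [i]] := boolP [forall i, 0 <= chi i x]; first by left.
by rewrite -ltNge; right; exists i.
Qed.

Lemma descent i t x : dominant x -> chi i (act t x) < 0 ->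
  exists2 t', (size t' < size t)%N & forall y, act t' y = refl i (act t y).
Proof.
move=> dx neg; apply: exchange; rewrite lt_neqAle chi_act_neq0//=.
by have := one_side i t dx; nra.
Qed.

(* The segment from a dominant point [x] to a point of the Tits cone starts
   inside a chamber whose closure contains [x]. *)
Lemma local_dominant x y t : dominant x -> dominant y ->
  exists u e, [/\ forall i, i \in u -> chi i x = 0, 0 < e
    & dominant (x + e *: act u (act t y))].
Proof.
move=> dx dy; elim/word_ind: t => t IH.
have [/existsP[i /andP[/eqP xi neg]]|] :=
    boolP [exists i, (chi i x == 0) && (chi i (act t y) < 0)].
  have [t' lt_t' t'E] := descent dy neg.
  have [u [e [uP e0 de]]] := IH t' lt_t'.
  exists (rcons u i), e; split=> // [k|]; last by rewrite act_rcons -t'E.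
  by rewrite mem_rcons inE => /predU1P[->|/uP].
rewrite negb_exists => /forallP pos.
(* No wall through [x] is in the way any more, and a short step reaches no other wall. *)
have [e e0 eP] := exists_small_step (fun k => chi k x) (fun k => chi k (act t y)).
exists [::], e; split=> // i; rewrite linearD linearZ /=.
have := dx i; rewrite le_eqVlt => /predU1P[xi|/eP/ltW//].
have := pos i; rewrite -xi eqxx -leNgt /= => ?.
by rewrite add0r mulr_ge0// ltW.
Qed.

(** * Faces of a cone stable under the reflections *)

Variable Y : set E.
Hypothesis Ycone : convex_cone Y.
Hypothesis Y_tits : forall y, Y y -> exists t z, dominant z /\ y = act t z.
Hypothesis Y_refl : forall i y, Y y -> Y (refl i y).
Implicit Types F : set E.

(** As [refl i] is an involution, this inclusion already means that [F] equals its image. *)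
Definition preserves F i := forall y, F y -> F (refl i y).
Definition fixes F i := forall y, F y -> chi i y = 0.
Definition generic F x :=
  [/\ core F x, dominant x & forall i, chi i x = 0 -> fixes F i].

Lemma Y_act t y : Y y -> Y (act t y).
Proof. by move=> Yy; elim: t => //= i t; apply: Y_refl. Qed.

(** The fixed point [x] is the sum of the images of [e *: y] and [x - e *: y], both in [Y], and a
    face contains such summands of its elements. *)
Lemma face_act_core F t x y : face Y F -> core F x -> act t x = x ->
  F y -> F (act t y).
Proof.
move=> Ff [Fx xP] tx Fy; have FY := face_sub Ff; have [e e0 Fe] := xP y Fy.
apply: (cone_unscale (face_cone Ff) e0); rewrite -actZ.
have [_ YZ] := Ycone.
apply: (face_summand Ff (y := act t (x - e *: y))).
- by apply/Y_act/YZ => //; apply: FY.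
- by apply/Y_act/FY.
- by rewrite -actD addrC subrK tx.
Qed.

(* The segment from [x] to [y] meets the wall of [i] in the core of the face. *)
Lemma preserves_crossing F i x y : face Y F -> core F x -> F y ->
  0 < chi i x -> chi i y < 0 -> preserves F i.
Proof.
move=> Ff cx Fy xi yi z Fz; pose e := chi i x / - chi i y.
have e0 : 0 < e by rewrite divr_gt0// oppr_gt0.
apply: (face_act_core (t := [:: i]) Ff (core_add_scale (face_cone Ff) cx Fy (ltW e0))) Fz.
apply: refl_fix; rewrite linearD linearZ /= /e invrN mulrN mulNr.
by rewrite divfK ?lt_eqF// subrr.
Qed.

(** Induction on the number of walls through [x]: while one of them does not contain the face, [x]
    can be moved off a wall among the dominant core points. *)
Lemma exists_generic F x : face Y F -> core F x -> dominant x ->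
  exists x', generic F x'.
Proof.
move=> Ff; have [m] := ubnP #|[pred i | chi i x == 0]|.
elim: m x => // m IH x xm cx dx.
have [xg|/existsNP[i /not_implyP[xi /existsNP[y /not_implyP[Fy /eqP yi]]]]] :=
    pselect (forall i, chi i x = 0 -> fixes F i).
  by exists x.
have [t [z [dz yE]]] := Y_tits (face_sub Ff Fy).
have [u [e [uP e0]]] := local_dominant t dx dz.
rewrite -yE => dxe.
have Fuy : F (act u y) by apply: face_act_core Ff cx (act_fix uP) Fy.
(* Half the step: the midpoint of two dominant points lies only on the walls through both. *)
pose x' := x + (e / 2) *: act u y.
have half k : chi k x' = (chi k x + chi k (x + e *: act u y)) / 2.
  by rewrite /x' !linearD !linearZ /=; lra.
apply: (IH x').
- rewrite ltnS in xm; apply: leq_trans xm; apply: proper_card; apply/properP; split.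
    apply/fintype.subsetP => k; rewrite !inE half => /eqP H; apply/eqP.
    by have := dx k; have := dxe k; lra.
  (* If [act u y] were on every wall through [x], the letters of [u] would fix it, so it would equal
     [y], which is off the wall of [i]. *)
  have [/existsP[k /andP[/eqP xk yk]]|] :=
      boolP [exists k, (chi k x == 0) && (chi k (act u y) != 0)].
    exists k; rewrite inE ?xk// /x' linearD linearZ /= xk add0r.
    by rewrite mulf_neq0// gt_eqF// divr_gt0.
  rewrite negb_exists => /forallP uy0.
  case/eqP: yi; have uy k : chi k x = 0 -> chi k (act u y) = 0.
    by move=> xk; apply/eqP; have := uy0 k; rewrite xk eqxx negbK.
  rewrite -(act_revK u y) (act_fix (t := rev u)) ?uy//.
  by move=> k; rewrite mem_rev => /uP /uy.
- by apply: core_add_scale (face_cone Ff) cx Fuy _; rewrite ltW// divr_gt0.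
- by move=> k; rewrite half divr_ge0// addr_ge0.
Qed.

Lemma act_preserves F t : (forall i, i \in t -> preserves F i) ->
  forall y, F y -> F (act t y).
Proof.
elim: t => //= i t IH tP y Fy; apply: (tP i (mem_head _ _)).
by apply: IH Fy => k kt; apply: tP; rewrite inE kt orbT.
Qed.

(** By [fundamental_domain], the stabilizer of the generic point [x] is generated by reflections in
    walls through [x], and these walls contain [F]. *)
Lemma pointwise_stabilizer F x t : generic F x -> (forall y, F y -> act t y = y) ->
  exists2 u, forall i, i \in u -> fixes F i & act u =1 act t.
Proof.
move=> [[Fx _] dx xP] tF; have [|_ [u uP uE]] := fundamental_domain (t := t) dx.
  by rewrite tF.
by exists u => // i /uP /xP.
Qed.

Lemma face_inclusion F1 F2 x1 x2 t : face Y F1 -> face Y F2 ->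
  generic F1 x1 -> generic F2 x2 -> (forall y, F1 y -> F2 (act t y)) ->
  F1 `<=` F2 /\ exists a b, [/\ forall i, i \in a -> preserves F2 i,
    forall i, i \in b -> fixes F1 i & act t =1 act (a ++ b)].
Proof.
move=> f1 f2 [[F1x1 cx1] dx1 x1P] [cx2 dx2 x2P].
elim/word_ind: t => t IH tF.
have [dtx|[i neg]] := dominantPn (act t x1).
  have [_ [u uP uE]] := fundamental_domain dx1 dtx.
  have uF i : i \in u -> fixes F1 i by move=> /uP /x1P.
  split; last by exists [::], u; split.
  move=> y F1y; rewrite -(act_fix (t := u) (x := y)) ?uE; first exact: tF.
  by move=> i /uF; apply.
have iF2 : preserves F2 i.
  apply: (preserves_crossing f2 cx2 (tF _ F1x1) _ neg).
  (* If the generic point [x2] were on the wall of [i], so would be all of [F2], including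
     [act t x1]. *)
  rewrite lt_neqAle dx2 andbT eq_sym; apply/eqP => /x2P /(_ _ (tF _ F1x1)).
  by move: neg => /[swap] ->; rewrite ltxx.
have [t' lt_t' t'E] := descent dx1 neg.
have [|F12 [a [b [aP bP abE]]]] := IH t' lt_t'.
  by move=> y F1y; rewrite t'E; apply/iF2/tF.
split=> //; exists (i :: a), b; split=> // [k|y].
  by rewrite inE => /predU1P[->|/aP].
by rewrite /= -abE t'E reflK.
Qed.

(* Words preserving [F] normalize the pointwise stabilizer of [F]. *)
Lemma preserves_decomposition F x a : generic F x ->
  (forall i, i \in a -> preserves F i) ->
  exists b c, [/\ forall i, i \in b -> fixes F i,
    forall i, i \in c -> preserves F i /\ ~ fixes F i & act a =1 act (b ++ c)].
Proof.
move=> gx; elim: a => [|i a IH] aP; first by exists [::], [::].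
have [|b [c [bP cP bcE]]] := IH.
  by move=> k ka; apply: aP; rewrite inE ka orbT.
have [iF|niF] := pselect (fixes F i).
  exists (i :: b), c; split=> // [k|y]; last by rewrite /= bcE.
  by rewrite inE => /predU1P[->|/bP].
have Fi := aP i (mem_head _ _).
(* To move [i] past [b], conjugate: the result still fixes [F] pointwise, hence is spelled by
   letters fixing [F]. *)
have [|b' b'P b'E] := pointwise_stabilizer (t := i :: rcons b i) gx.
  move=> y Fy; rewrite /= act_rcons act_fix ?reflK// => k /bP; apply.
  exact: Fi.
exists b', (i :: c); split=> // [k|y].
  by rewrite inE => /predU1P[->|/cP].
by rewrite act_cat b'E /= act_rcons reflK -act_cat bcE.
Qed.
End ReflectionChamber.

(** By relative openness the segment from [y] to [x] extends beyond [x] inside [A]; dividing its new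
    end by [1 + t] gives [x] minus a positive multiple of [y]. *)
Lemma ri_core (R : realType) (V : vectType R) (A : set V) x :
  convex_cone A -> ri A x -> core A x.
Proof.
move=> Ac [Ax [B [oB Bx BA]]]; split=> // y Ay.
have [AD AZ] := Ac.
pose e := vbasis {:V}; have eb : basis_of fullv e by exact: vbasisP.
have /nbhs_ballP[r /= r0 rB] : nbhs (passmx.rVof e x) (passmx.vecof e @^-1` B).
  by apply: open_nbhs_nbhs; split=> //=; rewrite passmx.rVofK.
pose S := 1 + \sum_i `|passmx.rVof e (x - y) 0 i|.
have S0 : 0 < S by rewrite ltr_pwDl// sumr_ge0.
pose t := r / S; have t0 : 0 < t by rewrite divr_gt0.
have At : A (x + t *: (x - y)).
  apply: BA; split.
    rewrite -(passmx.rVofK eb (x + t *: (x - y))); apply: rB.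
    split=> // i j; rewrite [i]ord1 -/e !mxE linearD linearZ /ball /=.
    rewrite opprD addNKr normrN normrM gtr0_norm// /t mulrAC ltr_pdivrMr// ltr_pM2l//.
    rewrite /S (bigD1 j)//= addrCA mxE ltrDl ltr_pwDl// sumr_ge0// => k _.
  move=> Z [Zaff AZ']; have := Zaff x y (1 + t) (AZ' _ Ax) (AZ' _ Ay).
  have -> : 1 - (1 + t) = - t by lra.
  by rewrite scaleNr scalerDl scale1r scalerBr addrA.
have t1 : 0 < 1 + t by rewrite addr_gt0.
exists (t / (1 + t)); first by rewrite divr_gt0.
have -> : x - (t / (1 + t)) *: y = (1 + t)^-1 *: (x + t *: (x - y)).
  rewrite scalerBr addrA -{2}[x]scale1r -scalerDl scalerBr !scalerA mulVf ?gt_eqF//.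
  by rewrite scale1r mulrC.
by apply: AZ => //; rewrite invr_gt0.
Qed.

(** * Evaluation of linear forms at points and on rays *)

Section Evaluation.
Variables (R : realType) (h : vectType R).

Definition eval_at (v : h) (l : 'Hom(h, R^o)) : R := l v.

Lemma eval_at_scalar v : scalar (eval_at v).
Proof. by move=> a l l'; rewrite /eval_at add_lfunE scale_lfunE. Qed.

HB.instance Definition _ v :=
  GRing.isLinear.Build R 'Hom(h, R^o) R *%R (eval_at v) (eval_at_scalar v).
End Evaluation.

Section Rays.
Variables (R : realType) (h : vectType R).
Implicit Types (v : h) (l : 'Hom(h, R^o)).
Let ray v : set h := [set t *: v | t in [set t : R | 0 <= t]].

Lemma ray_self v : ray v v.
Proof. by exists 1; rewrite /= ?ler01 ?scale1r. Qed.

Lemma nneg_on_ray v l : nneg_on (ray v) l <-> 0 <= eval_at v l.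
Proof.
split=> [/(_ _ (ray_self v))//|lv _ [t t0 <-]].
by rewrite linearZ; apply: mulr_ge0.
Qed.

Lemma zero_on_ray v l : zero_on (ray v) l <-> eval_at v l = 0.
Proof.
split=> [/(_ _ (ray_self v))//|lv _ [t t0 <-]].
by rewrite linearZ /= [l v]lv scaler0.
Qed.

Lemma pos_on_ray v l : v != 0 -> pos_on (ray v) l <-> 0 < eval_at v l.
Proof.
move=> v0; split=> [/(_ _ (ray_self v) v0)//|lv _ [t t0 <-] tv].
rewrite linearZ; apply: mulr_gt0 => //; rewrite lt_neqAle t0 andbT eq_sym.
by apply: contraNneq tv => ->; rewrite scale0r.
Qed.
End Rays.

(** * Linear Coxeter systems in terms of roots and coroots *)

Section LinearCoxeter.
Variables (R : realType) (h : vectType R) (n : nat).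
Variables (H : 'I_n -> set h) (L : 'I_n -> set 'Hom(h, R^o)).
Local Notation E := 'Hom(h, R^o).
Variables (v : 'I_n -> h) (alpha : 'I_n -> E).
Let chi i : {scalar E} := eval_at (v i).
Local Notation refl := (refl chi alpha).
Local Notation act := (act chi alpha).

Hypothesis HL : linear_coxeter_system H L.
Hypothesis v_neq0 : forall i, v i != 0.
Hypothesis HE : forall i, H i = [set t *: v i | t in [set t : R | 0 <= t]].
Hypothesis chi_alpha : forall i, chi i (alpha i) = 2.
Hypothesis sigmaE : forall i l, sigma H L i l = refl i l.

Definition word (t : seq 'I_n) : 'End(E) :=
  foldr (fun i g => sigma H L i \o g)%VF \1%VF t.

Lemma wordE t l : word t l = act t l.
Proof. by elim: t => [|i t IH] /=; rewrite lfunE //= sigmaE IH. Qed.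

Lemma word_ker0 t : lker (word t) == 0%VS.
Proof.
by apply/lker0P => x y; rewrite !wordE => /(can_inj (act_revK chi_alpha t)).
Qed.

Lemma word_inv t : ((word t)^-1)%VF = word (rev t).
Proof.
apply/lfunP => l; rewrite -[l in LHS](act_rev_K chi_alpha t) -wordE.
by rewrite (lker0_lfunK (word_ker0 t)) wordE.
Qed.

Lemma word_cat t u : word (t ++ u) = (word t \o word u)%VF.
Proof. by apply/lfunP => l; rewrite lfunE /= !wordE act_cat. Qed.

(** Words in [J] form a subgroup, reversal giving inverses, and every subgroup containing the
    generators contains them. *)
Lemma parabolicP (J : set 'I_n) s :
  parabolic H L J s <-> exists2 t, (forall i, i \in t -> J i) & s = word t.
Proof.
split=> [|[t tJ ->] S [[_ S1 SM _] SJ]]; last first.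
  elim: t tJ => //= i t IH tJ; apply: SM; first by apply: SJ; exists i => //; apply/tJ/mem_head.
  by apply: IH => k kt; apply: tJ; rewrite inE kt orbT.
move=> /(_ [set u | exists2 t, (forall i, i \in t -> J i) & u = word t]); apply.
split; last first.
  move=> _ [j Jj <-]; exists [:: j]; first by move=> i; rewrite inE => /eqP->.
  by rewrite /word /= comp_lfun1r.
split=> [_ [t _ ->]||_ _ [t tJ ->] [u uJ ->]|_ [t tJ ->]].
- exact: word_ker0.
- by exists [::].
- exists (t ++ u); last by rewrite word_cat.
  by move=> i; rewrite mem_cat => /orP[/tJ|/uJ].
- exists (rev t); last exact: word_inv.
  by move=> i; rewrite mem_rev => /tJ.
Qed.

Lemma W_word s : W H L s <-> exists t, s = word t.
Proof. by rewrite /W parabolicP; split=> [[t _]|[t]] ->; exists t. Qed.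

Lemma W_K s : W H L s -> cancel s (s^-1)%VF.
Proof. by move=> /W_word[t ->]; exact/lker0_lfunK/word_ker0. Qed.

Lemma W_VK s : W H L s -> cancel (s^-1)%VF s.
Proof. by move=> /W_word[t ->] l; rewrite word_inv !wordE act_rev_K. Qed.

Lemma CbarP l : Cbar H l <-> dominant chi l.
Proof.
split=> [Cl i|dl i _]; last by rewrite HE; apply/nneg_on_ray/dl.
by have := Cl i I; rewrite HE => /nneg_on_ray.
Qed.

Lemma CP l : C H l <-> chamber chi l.
Proof.
split=> [Cl i|dl i _]; last by rewrite HE; apply/pos_on_ray/dl.
by have := Cl i I; rewrite HE => /pos_on_ray; apply.
Qed.

Lemma zero_onP i l : zero_on (H i) l <-> chi i l = 0.
Proof. by rewrite HE; exact: zero_on_ray. Qed.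

Lemma scalarBZ (phi : {scalar E}) x a y : phi (x - a *: y) = phi x - a * phi y.
Proof. by rewrite linearB linearZ. Qed.

Lemma scalar_ker (phi : {scalar E}) :
  exists U : {vspace E}, forall x, x \in U <-> phi x = 0.
Proof.
have phi_lin : linear (phi : E -> R^o) by move=> a x y; rewrite linearP.
pose phiL := GRing.isLinear.Build R E R^o *:%R (phi : E -> R^o) phi_lin.
pose g : {linear E -> R^o} := HB.pack (phi : E -> R^o) phiL.
exists (lker (linfun g)) => x; rewrite memv_ker lfunE /=.
by split=> [/eqP|->].
Qed.

Lemma span_vanish A U (phi : {scalar E}) x : is_span A U ->
  (forall y, A y -> phi y = 0) -> x \in U -> phi x = 0.
Proof.
move=> [_ minU] A0 xU; have [K KP] := scalar_ker phi.
by apply/KP; apply: (subvP (minU K _)) xU => y /A0 /KP.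
Qed.

(** The span of the face lies in the kernel of [chi i], which is proper because
    [chi i (alpha i) = 2]; codimension one makes the two equal. *)
Lemma simple_wall_span i (phi : {scalar E}) :
  (forall x, dominant chi x -> chi i x = 0 -> phi x = 0) ->
  forall x, chi i x = 0 -> phi x = 0.
Proof.
move=> phi0 x xi.
have [_ [U [U' [UC U'F dimU]]]] :
    [set F | Fa (Cbar H) F /\ face_codim1 (Cbar H) F] (Cbar H `&` zero_on (H i)).
  by rewrite (lcs_faces HL); exists i.
have [K KP] := scalar_ker (chi i).
have U'K : (U' <= K)%VS.
  by have [_] := U'F; apply=> y [_ /zero_onP /KP].
have Uf : U = fullv.
  apply/eqP; rewrite eqEsubv subvf; have [_] := lcs_span HL; apply.
  by have [] := UC.
have KU' : (K <= U')%VS.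
  rewrite -(geq_leqif (dimv_leqif_sup U'K)) -ltnS -dimU Uf.
  rewrite (ltn_leqif (dimv_leqif_sup (subvf K))); apply/negP => /subvP.
  move=> /(_ (alpha i) (memvf _)) /KP; rewrite chi_alpha; lra.
apply: (span_vanish (phi := phi) U'F); last by apply/(subvP KU')/KP.
by move=> y [/CbarP dy /zero_onP yi]; apply: phi0.
Qed.

(** As [Cbar] spans, no [chi i] vanishes on it; dominant points with [chi i] positive, one for each
    [i], add up to a chamber point. *)
Lemma exists_chamber : exists c, chamber chi c.
Proof.
have /choice[g gP] i : exists l, dominant chi l /\ 0 < chi i l.
  apply: contrapT => /forallNP none.
  have : chi i (alpha i) = 0.
    apply: (span_vanish (lcs_span HL)) (memvf _) => y /CbarP dy.
    apply/eqP; rewrite eq_le dy andbT leNgt; apply/negP => yi.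
    by apply: (none y).
  by rewrite chi_alpha; lra.
exists (\sum_i g i) => i; rewrite linear_sum (bigD1 i)//=.
have [_ gi] := gP i; rewrite ltr_pwDl// sumr_ge0// => k _.
by have [/(_ i)] := gP k.
Qed.

(** If [chi k] vanished at all dominant points of the wall of [j], it would be proportional to
    [chi j], and the two faces would coincide, against [lcs_faces_inj]. *)
Lemma exists_wall_interior j :
  exists f, chi j f = 0 /\ forall k, k != j -> 0 < chi k f.
Proof.
have /choice[g gP] k : exists l, k != j -> [/\ dominant chi l, chi j l = 0 & 0 < chi k l].
  have [->|kj] := eqVneq k j; first by exists 0.
  apply: contrapT => /forallNP none.
  have ker_jk x : chi j x = 0 -> chi k x = 0.
    apply: (simple_wall_span (phi := chi k)) => {}x dx xj.
    apply/eqP; rewrite eq_le dx andbT leNgt; apply/negP => yi.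
    by apply: (none x).
  have chi_kE x : chi k x = chi j x / 2 * chi k (alpha j).
    apply/eqP; rewrite -subr_eq0; have := ker_jk (x - (chi j x / 2) *: alpha j).
    rewrite !(scalarBZ (chi _)) chi_alpha => e.
    by apply/eqP/e; lra.
  have chi_kj : chi k (alpha j) != 0.
    by apply/eqP => e; have := chi_kE (alpha k); rewrite e mulr0 chi_alpha; lra.
  case/eqP: kj; apply: (lcs_faces_inj HL); rewrite /=.
  apply/seteqP; split=> x [Cx /zero_onP x0]; split=> //; apply/zero_onP; last exact: ker_jk.
  move: x0; rewrite chi_kE => /eqP.
  by rewrite !mulf_eq0 (negPf chi_kj) orbF invr_eq0 pnatr_eq0 orbF => /eqP.
exists (\sum_(k | k != j) g k); split.
  by rewrite linear_sum big1//= => k /gP[].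
move=> k kj; rewrite linear_sum (bigD1 k)//=.
have [_ _ gk] := gP k kj; rewrite ltr_pwDl// sumr_ge0// => i /andP[ij _].
by have [/(_ k)] := gP i ij.
Qed.

Lemma act_chamber_free t c :
  chamber chi c -> chamber chi (act t c) -> act t =1 id.
Proof.
move=> cc ctc l; have [t1|tN1] := pselect (word t = \1%VF).
  by rewrite -wordE t1 lfunE.
have /W_word Wt : exists u, word t = word u by exists t.
suff : (@set0 E) (act t c) by [].
rewrite -(lcs_chamber HL Wt tN1); split; last exact/CP.
by exists c; [exact/CP|rewrite /= wordE].
Qed.

Lemma upsilonP F i : upsilon H L F i <-> preserves chi alpha F i.
Proof.
split=> [uF y Fy|pF]; first by rewrite -uF; exists y; rewrite ?sigmaE.
apply/seteqP; split=> [_ [y Fy <-]|y Fy]; first by rewrite sigmaE; apply: pF.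
by exists (refl i y); [exact: pF|rewrite sigmaE reflK].
Qed.

Lemma upsilon_lowerP F i : upsilon_lower H L F i <-> fixes chi F i.
Proof.
split=> uF y Fy; last by rewrite sigmaE refl_fix ?uF.
have := uF y Fy; rewrite sigmaE => e; have := chi_refl chi_alpha i y.
by rewrite e; lra.
Qed.

Lemma normW_word F t : (forall i, i \in t -> preserves chi alpha F i) ->
  normW H L F (word t).
Proof.
move=> tF; split; first by apply/W_word; exists t.
apply/seteqP; split=> [_ [y Fy <-]|y Fy].
  by rewrite wordE; exact: act_preserves tF _ Fy.
exists (act (rev t) y); last by rewrite wordE act_rev_K.
by apply: act_preserves Fy => i; rewrite mem_rev => /tF.
Qed.

Lemma normW_img F s y : normW H L F s -> F y -> F (s y).
Proof. by move=> [_ sF] Fy; rewrite -sF; exists y. Qed.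

Lemma normW_inv F s : normW H L F s -> normW H L F (s^-1)%VF.
Proof.
move=> [Ws sF]; split.
  by have /W_word[t ->] := Ws; rewrite word_inv; apply/W_word; exists (rev t).
apply/seteqP; split=> [_ [y + <-]|y Fy].
  by rewrite -{1}sF => -[z Fz <-]; rewrite W_K.
by exists (s y); [rewrite -sF; exists y|rewrite W_K].
Qed.

Lemma preserves_fixes F i : fixes chi F i -> preserves chi alpha F i.
Proof. by move=> iF y Fy; rewrite refl_fix// iF. Qed.

(** * Faces of an invariant subcone of the Tits cone *)

Section Subcone.
Variable Y : set E.
Hypotheses (Ycone : convex_cone Y) (Y_tits : Y `<=` tits_cone H L).
Hypothesis YW : W_invariant H L Y.

Lemma subcone_tits y : Y y -> exists t z, dominant chi z /\ y = act t z.
Proof.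
move=> /Y_tits[s /W_word[t ->] [z /CbarP dz <-]].
by exists t, z; rewrite wordE.
Qed.

Lemma subcone_refl i y : Y y -> Y (refl i y).
Proof.
have Wi : W H L (word [:: i]) by apply/W_word; exists [:: i].
by move=> Yy; rewrite -(YW Wi); exists y => //; rewrite wordE.
Qed.

Lemma Upsilon_generic F : Upsilon H Y F -> face Y F /\ exists x, generic chi F x.
Proof.
move=> [[Ff _] [x [rx /CbarP dx]]]; split=> //.
have [c0 c0P] := exists_chamber.
have /choice[f fP] := exists_wall_interior.
apply: (exists_generic chi_alpha c0P (fun i => (fP i).1) (fun i => (fP i).2)
  simple_wall_span act_chamber_free Ycone subcone_tits subcone_refl Ff _ dx).
exact: ri_core (face_cone Ff) rx.
Qed.

Lemma Upsilon_inclusion F1 F2 s : Upsilon H Y F1 -> Upsilon H Y F2 ->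
  W H L s -> (forall y, F1 y -> F2 (s y)) ->
  F1 `<=` F2 /\ exists a b, [/\ forall i, i \in a -> preserves chi alpha F2 i,
    forall i, i \in b -> fixes chi F1 i & s = word (a ++ b)].
Proof.
move=> /Upsilon_generic[f1 [x1 g1]] /Upsilon_generic[f2 [x2 g2]] /W_word[t ->] tF.
have [c0 c0P] := exists_chamber.
have /choice[f fP] := exists_wall_interior.
have [|F12 [a [b [aP bP abE]]]] := face_inclusion chi_alpha c0P (fun i => (fP i).1)
  (fun i => (fP i).2) simple_wall_span act_chamber_free Ycone subcone_refl
  f1 f2 g1 g2 (t := t).
  by move=> y /tF; rewrite wordE.
split=> //; exists a, b; split=> //.
by apply/lfunP => l; rewrite !wordE.
Qed.

Lemma Upsilon_decomposition F a : Upsilon H Y F ->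
  (forall i, i \in a -> preserves chi alpha F i) ->
  exists b c, [/\ forall i, i \in b -> fixes chi F i,
    forall i, i \in c -> preserves chi alpha F i /\ ~ fixes chi F i
    & word a = word (b ++ c)].
Proof.
move=> /Upsilon_generic[Ff [x gx]] aP.
have [c0 c0P] := exists_chamber.
have /choice[f fP] := exists_wall_interior.
have [b [c [bP cP abE]]] := preserves_decomposition chi_alpha c0P (fun i => (fP i).1)
  (fun i => (fP i).2) simple_wall_span act_chamber_free gx aP.
by exists b, c; split=> //; apply/lfunP => l; rewrite !wordE.
Qed.

Lemma normW_mulset R1 R2 : Upsilon H Y R1 -> Upsilon H Y R2 -> R1 `<=` R2 ->
  mulset (normW H L R1) (normW H L R2) =
  mulset (parabolic H L (upsilon_lower H L R1)) (parabolic H L (upsilon_upper H L R2)).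
Proof.
move=> hR1 hR2 R12; apply/seteqP; split=> _ [s1 + [s2 + <-]].
  move=> N1 N2; have [W1 _] := N1; have [W2 _] := N2.
  have [t1 t1E] := (W_word _).1 W1; have [t2 t2E] := (W_word _).1 W2.
  have invE : (s2^-1 \o s1^-1)%VF = word (rev (t1 ++ t2)).
    by rewrite t1E t2E !word_inv -word_cat rev_cat.
  (* The inverse of the product maps [R1] into [R2]; inverting its factorization [a ++ b] puts the
     letters fixing [R1] on the left. *)
  have [||_ [a [b [aP bP abE]]]] := Upsilon_inclusion (s := (s2^-1 \o s1^-1)%VF) hR1 hR2.
  - by rewrite invE; apply/W_word; eexists.
  - move=> y R1y; rewrite lfunE /=.
    exact/(normW_img (normW_inv N2))/R12/(normW_img (normW_inv N1)).
  have s12E : (s1 \o s2)%VF = word (rev b ++ rev a).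
    rewrite t1E t2E -word_cat -[t1 ++ t2]revK -word_inv -invE abE word_inv.
    by rewrite rev_cat.
  (* The letters of [c] fix [R2], hence also [R1], and join the left factor. *)
  have [|c [d [cP dP cdE]]] := Upsilon_decomposition (a := rev a) hR2.
    by move=> i; rewrite mem_rev => /aP.
  exists (word (rev b ++ c)).
    apply/parabolicP; exists (rev b ++ c) => // i.
    rewrite mem_cat mem_rev => /orP[/bP|/cP] iF; apply/upsilon_lowerP => // y R1y.
    exact/iF/R12.
  exists (word d).
    apply/parabolicP; exists d => // i /dP[iR2 nfix].
    by split; [exact/upsilonP|move=> /upsilon_lowerP].
  by rewrite -word_cat -catA word_cat -cdE -word_cat.
move=> /parabolicP[b bP ->] /parabolicP[d dP ->].
exists (word b); first by apply: normW_word => i /bP /upsilon_lowerP /preserves_fixes.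
exists (word d) => //.
by apply: normW_word => i /dP[/upsilonP].
Qed.

Lemma inclusion_equivalences R1 R2 s1 s2 :
  Upsilon H Y R1 -> Upsilon H Y R2 -> W H L s1 -> W H L s2 ->
  [<-> [set s1 l | l in R1] `<=` [set s2 l | l in R2] ;
       R1 `<=` R2 /\
         lcoset s1 (normW H L R1) `&` lcoset s2 (normW H L R2) !=set0 ;
       R1 `<=` R2 /\
         mulset (normW H L R1) (normW H L R2) (s1^-1 \o s2)%VF ].
Proof.
move=> hR1 hR2 W1 W2; tfae.
- move=> sub; have [t1 t1E] := (W_word _).1 W1; have [t2 t2E] := (W_word _).1 W2.
  have [||R12 [a [b [aP bP abE]]]] := Upsilon_inclusion (s := (s2^-1 \o s1)%VF) hR1 hR2.
  + by rewrite t1E t2E word_inv -word_cat; apply/W_word; eexists.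
  + move=> y R1y; rewrite lfunE /=.
    by have [|z R2z <-] := sub (s1 y); [exists y|rewrite W_K].
  (* As [s2^-1 \o s1 = word (a ++ b)], this element equals [s1 \o word (rev b)] and lies in both
     cosets. *)
  split=> //; exists (s2 \o word a)%VF; split; last first.
    by exists (word a) => //; apply: normW_word.
  exists (word (rev b)).
    apply: normW_word => i; rewrite mem_rev => /bP; exact: preserves_fixes.
  apply/lfunP => l; rewrite lfunE [RHS]lfunE /=.
  have /lfunP/(_ (word (rev b) l)) := abE.
  by rewrite lfunE word_cat [RHS]lfunE /= !(wordE b) wordE act_rev_K// => <-; rewrite W_VK.
- move=> [R12 [g [[n1 N1 <-] [n2 N2 e]]]]; split=> //.
  (* From [s1 \o n1 = s2 \o n2] follows [s1^-1 \o s2 = n1 \o n2^-1]. *)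
  exists n1 => //; exists (n2^-1)%VF; first exact: normW_inv.
  apply/lfunP => l; rewrite lfunE [RHS]lfunE /=.
  have /lfunP/(_ ((n2^-1)%VF l)) := e; rewrite lfunE [RHS]lfunE /= W_VK; last by case: N2.
  by move=> ->; rewrite W_K.
- move=> [R12 [n1 N1 [n2 N2 e]]] _ [y R1y <-].
  have R1y' := normW_img (normW_inv N1) R1y.
  exists ((n2^-1)%VF ((n1^-1)%VF y)); first exact/(normW_img (normW_inv N2))/R12.
  have /lfunP/(_ ((n2^-1)%VF ((n1^-1)%VF y))) := e.
  rewrite lfunE [RHS]lfunE /= W_VK; last by case: N2.
  rewrite W_VK; last by case: N1.
  by move=> /(congr1 s1); rewrite (W_VK W1) => ->.
Qed.

End Subcone.
End LinearCoxeter.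

(** The root is the generator of [Li] rescaled to the value 2 at [v]; each form is a multiple of it
    plus a form vanishing on [Hi]. *)
Lemma reflection_ray (R : realType) (h : vectType R) (Hi : set h)
    (Li : set 'Hom(h, R^o)) :
  closed_ray Hi -> closed_ray Li -> Li `\ 0 `<=` pos_on Hi ->
  exists va : h * 'Hom(h, R^o), [/\ va.1 != 0,
    Hi = [set t *: va.1 | t in [set t : R | 0 <= t]], eval_at va.1 va.2 = 2
    & forall l, reflection Hi Li l = l - eval_at va.1 l *: va.2].
Proof.
move=> rH rL HLpos; have [sH sL] := (reflectionP rH rL HLpos _).2 erefl.
have [v v0 HE] := rH; have [a a0 LE] := rL.
have La : Li a by rewrite LE; exact: ray_self.
have av : 0 < eval_at v a.
  by apply/(pos_on_ray _ v0); rewrite -HE; apply: HLpos; split=> //; apply/eqP.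
pose c : R := 2 / eval_at v a.
exists (v, c *: a); split=> //= [|l].
  by rewrite linearZ /= divfK// gt_eqF.
pose d := eval_at v l / eval_at v a.
rewrite -{1}[l](subrK (d *: a)) linearD [X in _ + X = _]linearZ /= (sL a La) sH.
  rewrite scalerN -addrA -opprD -scalerDl scalerA; congr (_ - _ *: _).
  by rewrite /d /c; field; rewrite gt_eqF.
by rewrite HE; apply/zero_on_ray; rewrite linearB linearZ /= /d divfK ?subrr// gt_eqF.
Qed.

Theorem theorem4p8 (R : realType) (h : vectType R) (n : nat)
    (H : 'I_n -> set h) (L : 'I_n -> set 'Hom(h, R^o))
    (HL : linear_coxeter_system H L)
    (Y : set 'Hom(h, R^o)) (Ycone : convex_cone Y)
    (YX : Y `<=` tits_cone H L) (YW : W_invariant H L Y) (Y0 : Y 0)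
    (R1 R2 : set 'Hom(h, R^o)) (hR1 : Upsilon H Y R1) (hR2 : Upsilon H Y R2)
    (s1 s2 : 'End('Hom(h, R^o))) (hs1 : W H L s1) (hs2 : W H L s2) :
  [<-> [set s1 l | l in R1] `<=` [set s2 l | l in R2] ;
       R1 `<=` R2 /\
         lcoset s1 (normW H L R1) `&` lcoset s2 (normW H L R2) !=set0 ;
       R1 `<=` R2 /\
         mulset (normW H L R1) (normW H L R2) (s1^-1 \o s2)%VF ]
  /\ (R1 `<=` R2 ->
      mulset (normW H L R1) (normW H L R2) =
      mulset (parabolic H L (upsilon_lower H L R1))
           (parabolic H L (upsilon_upper H L R2))).
Proof.
have /choice[va vaP] i :=
  reflection_ray (lcs_rayH HL i) (lcs_rayL HL i) (@lcs_pos _ _ _ _ _ HL i).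
have v0 i : (va i).1 != 0 by have [] := vaP i.
have HE i : H i = [set t *: (va i).1 | t in [set t : R | 0 <= t]] by have [] := vaP i.
have va2 i : eval_at (va i).1 (va i).2 = 2 by have [] := vaP i.
have sE i l : sigma H L i l = l - eval_at (va i).1 l *: (va i).2.
  by have [_ _ _ ->] := vaP i.
split.
  exact: (inclusion_equivalences HL v0 HE va2 sE Ycone YX YW hR1 hR2 hs1 hs2).
exact: (normW_mulset HL v0 HE va2 sE Ycone YX YW hR1 hR2).
Qed.
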